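(* Let $k$ be a positive natural number. If $k$ is squarefree, then the initial algebra $\mathit{Md}_k$ of the equational theory of meadows together with the equation $\underline{k}=0$ has exactly $k$ elements.
   Context: $\Sigma$ is the signature with constants $0,1$, binary operations $+,\cdot$, and unary operations $-$ and ${}^{-1}$, all total. A meadow is a $\Sigma$-algebra that is a commutative ring with unit (possibly trivial) and satisfies $(x^{-1})^{-1}=x$ and $x\cdot(x\cdot x^{-1})=x$ for all $x$; $\mathit{Md}$ denotes the corresponding set of equations. Numerals are defined by $\underline{0}=0$, $\underline{n+1}=\underline{n}+1$. For a positive natural number $k$, $\mathit{Md}_k$ is the initial algebra of $\mathit{Md}\cup\{\underline{k}=0\}$: the (unique up to isomorphism) meadow satisfying $\underline{k}=0$ that has exactly one $\Sigma$-homomorphism to every meadow satisfying $\underline{k}=0$; equivalently, closed $\Sigma$-terms modulo provable equality from $\mathit{Md}\cup\{\underline{k}=0\}$. A number is squarefree if it is a product of distinct primes. *)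

(* Defs.v *)
From HB Require Import structures.
From mathcomp Require Import all_boot all_algebra.
From mathcomp Require Import boolp.

Set Implicit Arguments.
Unset Strict Implicit.
Unset Printing Implicit Defensive.

Import GRing.Theory.
Local Open Scope ring_scope.
Local Open Scope quotient_scope.

(* [comPzRingType] does not require [1 != 0], so the trivial meadow is         *)
(* allowed. The total inverse is [minv]; it is unrelated to MathComp's [^-1],  *)
(* whose junk value outside the units is [x] itself.                           *)
HB.mixin Record ComPzRing_isMeadow R of GRing.ComPzRing R := {
  minv : R -> R;
  minvK : forall x, minv (minv x) = x;
  mulr_mulr_minv : forall x : R, x * (x * minv x) = x
}.

#[short(type="meadowType")]
HB.structure Definition Meadow := {R of ComPzRing_isMeadow R & GRing.ComPzRing R}.

(* A ring morphism automatically preserves [0], [1], [+], [*] and [-], so only *)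
(* the inverse remains to be added to get a homomorphism for the full          *)
(* signature of meadows.                                                       *)
Definition meadow_morphism (M N : meadowType) (f : {rmorphism M -> N}) : Prop :=
  forall x, f (minv x) = minv (f x).

(* The numeral of [k] in a ring is [k%:R]. *)
Definition initial_meadow (k : nat) (M : meadowType) : Prop :=
  k%:R = 0 :> M /\
  forall N : meadowType, k%:R = 0 :> N ->
    exists f : {rmorphism M -> N}, meadow_morphism f /\
      forall g : {rmorphism M -> N}, meadow_morphism g -> g =1 f.

Definition squarefree (k : nat) : Prop :=
  exists s : seq nat, [/\ uniq s, all prime s & k = (\prod_(p <- s) p)%N].

(* Existence: closed terms modulo provable equality form an initial meadow     *)
(* among those satisfying [k%:R = 0], for every [k].                           *)

Inductive term : Set :=
  | TZero | TOne
  | TAdd of term & term | TMul of term & term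
  | TOpp of term | TInv of term.

Fixpoint term_encode (t : term) : GenTree.tree unit :=
  match t with
  | TZero => GenTree.Node 0 [::]
  | TOne => GenTree.Node 1 [::]
  | TAdd t u => GenTree.Node 2 [:: term_encode t; term_encode u]
  | TMul t u => GenTree.Node 3 [:: term_encode t; term_encode u]
  | TOpp t => GenTree.Node 4 [:: term_encode t]
  | TInv t => GenTree.Node 5 [:: term_encode t]
  end.

Fixpoint term_decode (c : GenTree.tree unit) : term :=
  match c with
  | GenTree.Node 1 [::] => TOne
  | GenTree.Node 2 [:: a; b] => TAdd (term_decode a) (term_decode b)
  | GenTree.Node 3 [:: a; b] => TMul (term_decode a) (term_decode b)
  | GenTree.Node 4 [:: a] => TOpp (term_decode a)
  | GenTree.Node 5 [:: a] => TInv (term_decode a)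
  | _ => TZero
  end.

Lemma term_encodeK : cancel term_encode term_decode.
Proof. by elim=> //= [t -> u ->|t -> u ->|t ->|t ->]. Qed.

HB.instance Definition _ := Countable.copy term (can_type term_encodeK).

Fixpoint numeral (n : nat) : term :=
  if n is m.+1 then TAdd (numeral m) TOne else TZero.

Inductive provable (k : nat) : term -> term -> Prop :=
  | PRefl t : provable k t t
  | PSym t u : provable k t u -> provable k u t
  | PTrans t u v : provable k t u -> provable k u v -> provable k t v
  | PAdd t t' u u' :
      provable k t t' -> provable k u u' -> provable k (TAdd t u) (TAdd t' u')
  | PMul t t' u u' :
      provable k t t' -> provable k u u' -> provable k (TMul t u) (TMul t' u')
  | POpp t t' : provable k t t' -> provable k (TOpp t) (TOpp t')
  | PInv t t' : provable k t t' -> provable k (TInv t) (TInv t')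
  | PAddA t u v : provable k (TAdd t (TAdd u v)) (TAdd (TAdd t u) v)
  | PAddC t u : provable k (TAdd t u) (TAdd u t)
  | PAdd0 t : provable k (TAdd TZero t) t
  | PAddN t : provable k (TAdd (TOpp t) t) TZero
  | PMulA t u v : provable k (TMul t (TMul u v)) (TMul (TMul t u) v)
  | PMulC t u : provable k (TMul t u) (TMul u t)
  | PMul1 t : provable k (TMul TOne t) t
  | PMulD t u v :
      provable k (TMul (TAdd t u) v) (TAdd (TMul t v) (TMul u v))
  | PInvK t : provable k (TInv (TInv t)) t
  | PRIL t : provable k (TMul t (TMul t (TInv t))) t
  | PNum : provable k (numeral k) TZero.

Section TermModel.
Variable k : nat.

Definition provableb : rel term := fun t u => `[< provable k t u >].

Lemma provableb_equiv : equiv_class_of provableb.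
Proof.
split=> [t|t u|u t v].
- exact/asboolP/PRefl.
- by apply/asboolP/asboolP => /PSym.
- by move=> /asboolP tu /asboolP uv; apply/asboolP/(PTrans tu uv).
Qed.

Canonical provable_equiv := EquivRelPack provableb_equiv.

Definition Md := {eq_quot provable_equiv}.
HB.instance Definition _ := Choice.on Md.
HB.instance Definition _ := EqQuotient.on Md.

Definition tpi (t : term) : Md := \pi_Md t.

Lemma tpiP t u : tpi t = tpi u <-> provable k t u.
Proof. by split=> [/eqmodP/asboolP|tu] //; apply/eqmodP/asboolP. Qed.

Lemma tpi_repr (x : Md) : tpi (repr x) = x. Proof. exact: reprK. Qed.

Lemma repr_tpi t : provable k (repr (tpi t)) t.
Proof. by apply/tpiP; rewrite tpi_repr. Qed.

Lemma tpi_ind (P : Md -> Prop) : (forall t, P (tpi t)) -> forall x, P x.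
Proof. by move=> Pt x; rewrite -[x]tpi_repr. Qed.

Definition madd (x y : Md) : Md := tpi (TAdd (repr x) (repr y)).
Definition mmul (x y : Md) : Md := tpi (TMul (repr x) (repr y)).
Definition mopp (x : Md) : Md := tpi (TOpp (repr x)).
Definition mdinv (x : Md) : Md := tpi (TInv (repr x)).

Lemma maddE t u : madd (tpi t) (tpi u) = tpi (TAdd t u).
Proof. by apply/tpiP/PAdd; apply: repr_tpi. Qed.
Lemma mmulE t u : mmul (tpi t) (tpi u) = tpi (TMul t u).
Proof. by apply/tpiP/PMul; apply: repr_tpi. Qed.
Lemma moppE t : mopp (tpi t) = tpi (TOpp t).
Proof. exact/tpiP/POpp/repr_tpi. Qed.
Lemma mdinvE t : mdinv (tpi t) = tpi (TInv t).
Proof. exact/tpiP/PInv/repr_tpi. Qed.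

Fact maddA : associative madd.
Proof.
elim/tpi_ind=> t; elim/tpi_ind=> u; elim/tpi_ind=> v.
by rewrite !maddE; apply/tpiP/PAddA.
Qed.
Fact maddC : commutative madd.
Proof.
by elim/tpi_ind=> t; elim/tpi_ind=> u; rewrite !maddE; apply/tpiP/PAddC.
Qed.
Fact madd0 : left_id (tpi TZero) madd.
Proof. by elim/tpi_ind=> t; rewrite maddE; apply/tpiP/PAdd0. Qed.
Fact maddN : left_inverse (tpi TZero) mopp madd.
Proof. by elim/tpi_ind=> t; rewrite moppE maddE; apply/tpiP/PAddN. Qed.
HB.instance Definition _ :=
  GRing.isZmodule.Build Md maddA maddC madd0 maddN.

Fact mmulA : associative mmul.
Proof.
elim/tpi_ind=> t; elim/tpi_ind=> u; elim/tpi_ind=> v.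
by rewrite !mmulE; apply/tpiP/PMulA.
Qed.
Fact mmulC : commutative mmul.
Proof.
by elim/tpi_ind=> t; elim/tpi_ind=> u; rewrite !mmulE; apply/tpiP/PMulC.
Qed.
Fact mmul1 : left_id (tpi TOne) mmul.
Proof. by elim/tpi_ind=> t; rewrite mmulE; apply/tpiP/PMul1. Qed.
Fact mmulD : left_distributive mmul madd.
Proof.
elim/tpi_ind=> t; elim/tpi_ind=> u; elim/tpi_ind=> v.
by rewrite maddE !mmulE maddE; apply/tpiP/PMulD.
Qed.
HB.instance Definition _ :=
  GRing.Zmodule_isComPzRing.Build Md mmulA mmulC mmul1 mmulD.

Fact mdinvK (x : Md) : mdinv (mdinv x) = x.
Proof. by elim/tpi_ind: x => t; rewrite !mdinvE; apply/tpiP/PInvK. Qed.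
Fact mdRIL (x : Md) : x * (x * mdinv x) = x.
Proof.
elim/tpi_ind: x => t; rewrite mdinvE.
by rewrite [X in _ * X]mmulE [LHS]mmulE; apply/tpiP/PRIL.
Qed.
HB.instance Definition _ := ComPzRing_isMeadow.Build Md mdinvK mdRIL.

Fixpoint teval (N : meadowType) (t : term) : N :=
  match t with
  | TZero => 0
  | TOne => 1
  | TAdd t u => teval N t + teval N u
  | TMul t u => teval N t * teval N u
  | TOpp t => - teval N t
  | TInv t => minv (teval N t)
  end.

Lemma teval_numeral (N : meadowType) n : teval N (numeral n) = n%:R.
Proof. by elim: n => //= n ->; rewrite -natr1. Qed.

Lemma teval_sound (N : meadowType) t u :
  k%:R = 0 :> N -> provable k t u -> teval N t = teval N u.
Proof.
move=> k0; elim=> {t u} //=.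
- by move=> t u v _ -> _ ->.
- by move=> t t' u u' _ -> _ ->.
- by move=> t t' u u' _ -> _ ->.
- by move=> t t' _ ->.
- by move=> t t' _ ->.
- by move=> t u v; rewrite addrA.
- by move=> t u; rewrite addrC.
- by move=> t; rewrite add0r.
- by move=> t; rewrite addNr.
- by move=> t u v; rewrite mulrA.
- by move=> t u; rewrite mulrC.
- by move=> t; rewrite mul1r.
- by move=> t u v; rewrite mulrDl.
- by move=> t; rewrite minvK.
- by move=> t; rewrite mulr_mulr_minv.
- by rewrite teval_numeral.
Qed.

Lemma teval_tpi t : teval Md t = tpi t.
Proof.
by elim: t => //= [t -> u ->|t -> u ->|t ->|t ->];
  [exact: maddE | exact: mmulE | exact: moppE | exact: mdinvE].
Qed.

Lemma morph_teval (N : meadowType) (g : {rmorphism Md -> N}) t :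
  meadow_morphism g -> g (tpi t) = teval N t.
Proof.
move=> gV; rewrite -teval_tpi; elim: t => /=.
- exact: rmorph0.
- exact: rmorph1.
- by move=> t <- u <-; rewrite rmorphD.
- by move=> t <- u <-; rewrite rmorphM.
- by move=> t <-; rewrite rmorphN.
- by move=> t <-; rewrite gV.
Qed.

Lemma Md_initial : initial_meadow k Md.
Proof.
split=> [|N k0].
  rewrite -teval_numeral teval_tpi; exact/tpiP/PNum.
pose f (x : Md) : N := teval N (repr x).
have fE t : f (tpi t) = teval N t by apply/(teval_sound k0)/repr_tpi.
have fB : zmod_morphism f.
  elim/tpi_ind=> t; elim/tpi_ind=> u.
  by rewrite [- tpi u]moppE [tpi t + _]maddE !fE.
have fM : monoid_morphism f.
  split=> [|x y]; first exact: (fE TOne).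
  by elim/tpi_ind: x => t; elim/tpi_ind: y => u; rewrite [_ * _]mmulE !fE.
pose fA := GRing.isZmodMorphism.Build Md N f fB.
pose fR := GRing.isMonoidMorphism.Build Md N f fM.
pose F : {rmorphism Md -> N} := HB.pack f fA fR.
exists F; split=> [x|g gV x].
  elim/tpi_ind: x => t; rewrite [minv (tpi t)]mdinvE.
  exact: etrans (fE (TInv t)) (congr1 minv (esym (fE t))).
by elim/tpi_ind: x => t; rewrite morph_teval //; exact: esym (fE t).
Qed.

End TermModel.

(* Main.v *)
From HB Require Import structures.
Require Import Defs.
From mathcomp Require Import all_boot all_algebra.
From mathcomp Require Import zify.

(** For squarefree k, Fermat's little theorem at each prime factor of k yields
    an e > 0 with x^(1 + e j) = x in Z/k for all x and j, so that
    x |-> x^(2e - 1) makes Z/k a meadow. In a meadow x^-1 is the only y with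
    x (x y) = x and y (y x) = y, so every ring morphism between meadows
    preserves the inverse. Hence the unique morphism from an initial meadow M
    to Z/k and the map i |-> i from Z/k to M are mutually inverse. *)

Import GRing.Theory.
Local Open Scope ring_scope.

(** With [z := minv x]: [x y = (x x z) y = (x x y) z = x z], and then
    [z = z z x = z x y = y x y = y]. *)
Lemma minv_uniq (M : meadowType) (x y : M) :
  x * (x * y) = x -> y * (y * x) = y -> minv x = y.
Proof.
move=> xxy yyx; set z := minv x.
have xxz : x * (x * z) = x by exact: mulr_mulr_minv.
have zzx : z * (z * x) = z by have:= mulr_mulr_minv z; rewrite minvK.
have xy_xz : x * y = x * z.
  by rewrite -{1}xxz mulrA mulrAC -(mulrA x x y) xxy.
rewrite -zzx -[RHS]yyx (mulrC z x) (mulrC y x).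
by rewrite -xy_xz mulrCA (mulrC z) xy_xz -mulrCA.
Qed.

Lemma rmorph_minv (M N : meadowType) (f : {rmorphism M -> N}) :
  meadow_morphism f.
Proof.
move=> x; apply/esym/minv_uniq; rewrite -!rmorphM ?mulr_mulr_minv //.
by have:= mulr_mulr_minv (minv x); rewrite minvK => ->.
Qed.

Lemma fermat_little_iter (p x j : nat) :
  prime p -> (x ^ (p.-1 * j).+1 = x %[mod p])%N.
Proof.
move=> p_pr; elim: j => [|j IHj]; first by rewrite muln0 expn1.
rewrite mulnS -addnS expnD -modnMmr IHj modnMmr -expnSr prednK ?prime_gt0 //.
exact: fermat_little.
Qed.

Lemma prod_primes_dvdn (s : seq nat) (n : nat) :
  uniq s -> all prime s -> (forall p, p \in s -> p %| n)%N ->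
  (\prod_(p <- s) p %| n)%N.
Proof.
elim: s => [|p s IHs] /=; first by rewrite big_nil dvd1n.
case/andP=> p_s s_uniq /andP[p_pr s_pr] s_dvd; rewrite big_cons Gauss_dvd.
  rewrite s_dvd ?mem_head // IHs // => q q_s.
  by rewrite s_dvd // inE q_s orbT.
rewrite prime_coprime // Euclid_dvd_prod // big_has; apply/hasPn=> q q_s.
by rewrite dvdn_prime2 ?(allP s_pr q) //; apply: contraNneq p_s => ->.
Qed.

Lemma squarefree_expn (k : nat) : squarefree k ->
  exists e, forall j x, (x ^ (e.+1 * j).+1 = x %[mod k])%N.
Proof.
case=> s [s_uniq s_pr ->]; pose d := (\prod_(p <- s) p.-1)%N.
have d_gt0 : (0 < d)%N.
  rewrite /d big_seq prodn_cond_gt0 // => p /(allP s_pr) /prime_gt1.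
  by case: p => [|[]].
exists d.-1 => j x; rewrite prednK //; apply/eqP.
(* [eqn_mod_dvd] speaks of a truncated difference, hence needs this order. *)
have le_x : (x <= x ^ (d * j).+1)%N.
  by rewrite expnS; case: x => // x; rewrite leq_pmulr ?expn_gt0.
rewrite eqn_mod_dvd //; apply: prod_primes_dvdn => // p p_s.
rewrite -eqn_mod_dvd //; apply/eqP.
(* The product [d] serves all primes at once, being a multiple of each [p.-1]. *)
have /dvdnP[q ->] : (p.-1 %| d)%N by rewrite /d (big_rem p) //= dvdn_mulr.
by rewrite (mulnC q) -mulnA; apply: fermat_little_iter; apply: (allP s_pr).
Qed.

(* An alias of ['I_n.+1], on which MathComp puts a ring structure only for
   [n > 0]; here [n = 0] has to give the trivial ring. *)
Definition Zmod (n : nat) : Type := 'I_n.+1.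

HB.instance Definition _ n := GRing.Zmodule.on (Zmod n).
HB.instance Definition _ n := GRing.Zmodule_isComPzRing.Build (Zmod n)
  (@Zp_mulA _) (@Zp_mulC _) (@Zp_mul1z n) (@Zp_mul_addl _).

Lemma Zmod_nat (n m : nat) : m%:R = inZp m :> Zmod n.
Proof.
by rewrite [m%:R](@Zp_mulrn n Zp1 m); apply: val_inj; rewrite /= modnMml mul1n.
Qed.

Lemma Zmod_exp (n m : nat) (x : Zmod n) : x ^+ m = inZp (val x ^ m).
Proof.
elim: m => [|m IHm]; first exact: Zmod_nat n 1%N.
rewrite exprS IHm; apply: val_inj.
by rewrite /= modnMmr expnS.
Qed.

Lemma natr_mod (R : pzRingType) (k m : nat) :
  k%:R = 0 :> R -> (m %% k)%:R = m%:R :> R.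
Proof. by move=> k0; rewrite {2}(divn_eq m k) natrD natrM k0 mulr0 add0r. Qed.

Theorem theorem4p4 (k : nat) (M : meadowType) (k_gt0 : (0 < k)%N)
  (k_sqf : squarefree k) (M_init : initial_meadow k M) :
  exists f : 'I_k -> M, bijective f.
Proof.
case: k k_gt0 k_sqf M_init => // n _ /squarefree_expn[e eP] [k0 M_init].
have expE j (x : Zmod n) : x ^+ (e.+1 * j).+1 = x.
  by rewrite Zmod_exp; apply: val_inj; rewrite /= eP modZp.
(* The period is [e.+1] and the exponent [2(e+1) - 1]. Without the doubling, [e = 0] would give
   [x ^+ 0 = 1], even at [x = 0]. *)
pose inv (x : Zmod n) := x ^+ e.*2.+1.
(* [(2e+1)^2 = (e+1)(4e) + 1]. *)
have invK x : inv (inv x) = x.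
  by rewrite /inv -exprM -[RHS](expE (4 * e)%N); congr (_ ^+ _); lia.
have mul_inv x : x * (x * inv x) = x.
  by rewrite /inv -!exprS -[RHS](expE 2%N); congr (_ ^+ _); lia.
pose invP := ComPzRing_isMeadow.Build (Zmod n) invK mul_inv.
pose N : meadowType := HB.pack (Zmod n) invP.
pose g (x : N) : M := (val (x : 'I_n.+1))%:R.
have gE m : g (inZp m) = m%:R by exact: natr_mod.
have gB : zmod_morphism g.
  (* Moving [g y] across the equation leaves a sum, so no opposite of a residue has to be
     computed. *)
  move=> x y; apply/eqP; rewrite eq_sym subr_eq; apply/eqP.
  rewrite -{1}[x](subrK y); set z := x - y.
  by rewrite /g -natrD; exact: natr_mod.
have gM : monoid_morphism g.
  by split=> [|x y]; [exact: gE 1%N | rewrite /g -natrM; exact: natr_mod].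
pose G : {rmorphism N -> M} := HB.pack g
  (GRing.isZmodMorphism.Build N M g gB) (GRing.isMonoidMorphism.Build N M g gM).
have [|f _] := M_init N.
  by rewrite [LHS](Zmod_nat n n.+1); apply: val_inj; rewrite /= modnn.
(* Initiality of [M] applied to [M] itself: the endomorphisms [G \o f] and [idfun] both equal [h],
   so [f] is a right inverse of [g]. *)
have [h [_ h_uniq]] := M_init M k0.
exists g, f => x.
  by rewrite /g rmorph_nat (Zmod_nat n) valZpK.
rewrite [LHS](h_uniq (G \o f : {rmorphism M -> M}) (rmorph_minv _ _ _)).
by rewrite -(h_uniq (idfun : {rmorphism M -> M}) (rmorph_minv _ _ _)).
Qed.
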